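(* Let $G$ be a graph. If $6 \leq \chi(G) = \left\lfloor \frac{\theta(G)}{2} \right\rfloor + 1$, then $G$ contains the complete graph $K_{\chi(G)}$ as a subgraph.
   Context: Graphs are finite and simple, $\chi(G)$ is the chromatic number of $G$ and $d(x)$ is the degree of a vertex $x$. The Ore-degree of an edge $xy$ in a graph $G$ is $\theta(xy) = d(x) + d(y)$. The Ore-degree of a graph $G$ is $\theta(G) = \max_{xy \in E(G)} \theta(xy)$. *)

(* Defs.v *)
From mathcomp Require Import all_boot.

Set Implicit Arguments.
Unset Strict Implicit.
Unset Printing Implicit Defensive.

Record sgraph := SGraph {
  vertex :> finType;
  adj : rel vertex;
  adj_sym : symmetric adj;
  adj_irrefl : irreflexive adj
}.

Definition degree (G : sgraph) (x : G) : nat := #|[set y | adj x y]|.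

Definition edge_ore_degree (G : sgraph) (x y : G) : nat := degree x + degree y.

(* Each edge is counted in both orientations, which does not affect the
   maximum; an edgeless graph gets the value 0. *)
Definition ore_degree (G : sgraph) : nat :=
  \max_(e : G * G | adj e.1 e.2) edge_ore_degree e.1 e.2.

Definition proper_coloring (G : sgraph) (k : nat) (c : {ffun G -> 'I_k}) : bool :=
  [forall x, forall y, adj x y ==> (c x != c y)].

Definition colorable (G : sgraph) (k : nat) : bool :=
  [exists c : {ffun G -> 'I_k}, proper_coloring c].

Lemma colorable_ex (G : sgraph) : exists k, colorable G k.
Proof.
exists #|G|; apply/existsP; exists [ffun x => enum_rank x].
apply/forallP=> x; apply/forallP=> y; apply/implyP=> xy.
rewrite !ffunE; apply/eqP=> /enum_rank_inj eq_xy.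
by rewrite eq_xy adj_irrefl in xy.
Qed.

Definition chromatic_number (G : sgraph) : nat := ex_minn (colorable_ex G).

Lemma complete_adj_sym (n : nat) : symmetric (fun i j : 'I_n => i != j).
Proof. by move=> i j; rewrite eq_sym. Qed.

Lemma complete_adj_irrefl (n : nat) : irreflexive (fun i j : 'I_n => i != j).
Proof. by move=> i; rewrite eqxx. Qed.

Definition complete_graph (n : nat) : sgraph :=
  SGraph (@complete_adj_sym n) (@complete_adj_irrefl n).

(* Subgraphs need not be induced: edges are preserved but not reflected. *)
Definition contains_subgraph (G H : sgraph) : Prop :=
  exists f : H -> G,
    injective f /\ forall u v : H, adj u v -> adj (f u) (f v).

(* Main.v *)
Require Import Defs.
From mathcomp Require Import all_boot.
From mathcomp Require Import zify.

Set Implicit Arguments.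
Unset Strict Implicit.
Unset Printing Implicit Defensive.

(** Let n = chi(G) - 1 and pass to a vertex-minimal induced subgraph that is not
    n-colourable.  Its degrees are n ("low") or n + 1 ("high"), and no two high
    vertices are adjacent.  Split the n >= 5 colours into a part of two colours
    and a part of n - 2 >= 3 colours, and consider proper colourings of all
    vertices but one low vertex x, with as few edges as possible inside the two
    parts.  By minimality (Mozhan), x may be exchanged with any vertex of its
    component in a part, and these components are regular; hence by Brooks'
    theorem x together with its neighbours in the big part is a complete
    component there, while in the two-coloured part two low vertices of the
    component of x are adjacent, since low/high is not a proper 2-colouring.
    If such adjacent w, y have the same neighbours in the big part, these
    neighbours, w, y and a third vertex form K_(n+1), or K_(n+1) minus an edge
    with high ends, which is reducible.  Otherwise the uncoloured vertex can walk
    for ever: it leaves its two-coloured component through y, and the component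
    can never be entered again, because w keeps neighbours in two different
    components of the big part. *)

(** * Greedy colouring *)

Section ListColoring.

Variables (T C : finType) (e : rel T).
Hypotheses (e_sym : symmetric e) (e_irr : irreflexive e).

Definition nbr (x : T) : {set T} := [set y | e x y].

Definition proper_on (Q : {set T}) (c : T -> C) :=
  {in Q &, forall u v, e u v -> c u != c v}.

Definition recolor (c : T -> C) (x : T) (i : C) : T -> C :=
  fun v => if v == x then i else c v.

Lemma recolor_same c x i : recolor c x i x = i.
Proof. by rewrite /recolor eqxx. Qed.

Lemma recolor_other c x i v : v != x -> recolor c x i v = c v.
Proof. by rewrite /recolor => /negbTE ->. Qed.

Lemma nbrE x y : (y \in nbr x) = e x y. Proof. by rewrite inE. Qed.

Lemma proper_on_recolor (Q : {set T}) c x i :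
  proper_on (Q :\ x) c ->
  {in Q, forall v, v != x -> e x v -> c v != i} ->
  proper_on Q (recolor c x i).
Proof.
move=> cP iP u v uQ vQ uv; rewrite /recolor.
have uv' : u != v by apply: contraTneq uv => ->; rewrite e_irr.
case: (eqVneq u x) => [ux|ux].
  have vx : v != x by rewrite -ux eq_sym.
  by rewrite (negbTE vx) eq_sym; apply: iP => //; rewrite -ux.
case: (eqVneq v x) => [vx|vx]; first by apply: iP => //; rewrite -vx e_sym.
by apply: cP => //; rewrite !inE ?ux ?vx.
Qed.

Definition twin_nbrs (Q : {set T}) (c : T -> C) (s : T) :=
  exists a b, [/\ a \in Q, b \in Q, e s a, e s b & a != b /\ c a = c b].

(** [Q] is the set coloured beforehand and [l] is coloured from its head. Each vertex still has an
    uncoloured neighbour further on in [l], or already sees one colour twice in [Q]. *)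
Fixpoint greedy_order (Q : {set T}) (c : T -> C) (l : seq T) : Prop :=
  if l is s :: l' then
    (has (e s) l' \/ twin_nbrs Q c s) /\ greedy_order Q c l'
  else True.

Lemma twin_nbrsW (Q Q' : {set T}) c c' s :
  Q \subset Q' -> {in Q, c' =1 c} -> twin_nbrs Q c s -> twin_nbrs Q' c' s.
Proof.
move=> sQ cc [a [b [aQ bQ sa sb [ab cab]]]]; exists a, b.
by split; rewrite ?(subsetP sQ) // !cc.
Qed.

Lemma greedy_orderW (Q Q' : {set T}) c c' l :
  Q \subset Q' -> {in Q, c' =1 c} -> greedy_order Q c l -> greedy_order Q' c' l.
Proof.
move=> sQ cc; elim: l => //= s l IH [Hs /IH Hl]; split=> //.
by case: Hs => [?|Hs]; [left | right; apply: twin_nbrsW Hs].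
Qed.

(** At its turn [s] has at most [#|D|] neighbours in [Q], and either one of them is still uncoloured
    or two share a colour. So fewer than [#|D|] colours are forbidden. *)
Lemma greedy_coloring (D : {set C}) (Q : {set T}) (l : seq T) (c : T -> C) :
  uniq l -> {subset l <= Q} -> {in l, forall s, #|nbr s :&: Q| <= #|D|} ->
  proper_on (Q :\: [set s in l]) c -> {in Q :\: [set s in l], forall v, c v \in D} ->
  greedy_order (Q :\: [set s in l]) c l ->
  exists c', [/\ proper_on Q c', {in Q, forall v, c' v \in D} &
                 {in Q :\: [set s in l], c' =1 c}].
Proof.
elim: l c => [|s l IH] c /=.
  have -> : [set s in [::]] = set0 :> {set T} by apply/setP=> v; rewrite !inE.
  by rewrite setD0 => *; exists c.
move=> /andP[sl ul] lQ degl cP cD [Hs Hl].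
have sQ : s \in Q by apply: lQ; rewrite inE eqxx.
pose R := Q :\: [set v in s :: l].
have RE : R = (Q :\: [set v in l]) :\ s.
  by apply/setP=> v; rewrite !inE negb_or andbA.
pose F := c @: (nbr s :&: R).
have ltF : #|F| < #|D|.
  have sub : nbr s :&: R \subset nbr s :&: Q by rewrite setIS // subsetDl.
  case: Hs => [/hasP[w wl sw]|[a [b [aR bR sa sb [ab cab]]]]].
    apply: leq_ltn_trans (leq_imset_card _ _) _.
    apply: leq_trans (degl s _); last by rewrite inE eqxx.
    apply: proper_card; apply/properP; split=> //; exists w.
      by rewrite !inE sw lQ // inE wl orbT.
    by rewrite !inE wl orbT andbF.
  have -> : F = c @: ((nbr s :&: R) :\ a).
    apply/setP=> i; apply/imsetP/imsetP=> [[v vR ->]|[v /setD1P[_ vR] ->]].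
      case: (eqVneq v a) => [->|va]; last by exists v => //; apply/setD1P.
      by exists b => //; rewrite in_setD1 eq_sym ab in_setI nbrE sb bR.
    by exists v.
  apply: leq_ltn_trans (leq_imset_card _ _) _.
  have := cardsD1 a (nbr s :&: R); rewrite in_setI nbrE sa aR /= => E.
  have := subset_leq_card sub; have := degl s; rewrite inE eqxx => /(_ isT).
  lia.
have [i iD iF] : exists2 i, i \in D & i \notin F.
  have : ~~ (D \subset F) by apply/negP => /subset_leq_card; rewrite leqNgt ltF.
  by case/subsetPn=> i; exists i.
have eqc : {in R, recolor c s i =1 c}.
  by move=> v; rewrite RE in_setD1 => /andP[vs _]; rewrite recolor_other.
have RsubR : R \subset Q :\: [set v in l] by rewrite RE subsetDl.
have [||||||c' [c'P c'D c'E]] := IH (recolor c s i) => //.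
- by move=> v vl; apply: lQ; rewrite inE vl orbT.
- by move=> v vl; apply: degl; rewrite inE vl orbT.
- apply: proper_on_recolor; first by rewrite -RE.
  move=> v vQ vs sv; apply: contraNneq iF => <-; apply: imset_f.
  by rewrite in_setI nbrE sv RE in_setD1 vs.
- move=> v vQ; case: (eqVneq v s) => [->|vs]; first by rewrite recolor_same.
  by rewrite recolor_other // cD // -/R RE in_setD1 vs.
- by apply: greedy_orderW Hl.
exists c'; split=> // v vR.
by rewrite c'E ?eqc // (subsetP RsubR).
Qed.

(** Along the path each vertex of [s1] is followed by an uncoloured neighbour; for the last one this
    is [q], which lies in [l]. *)
Lemma greedy_order_path (Q : {set T}) c a s1 q s2 l :
  path e a (s1 ++ q :: s2) -> q \in l -> greedy_order Q c l ->
  greedy_order Q c (s1 ++ l).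
Proof.
move=> ep ql Hl; elim: s1 a ep => [|b s1 IH] a //= /andP[_ ep].
split; last exact: IH ep.
left; case: s1 ep {IH} => [|b' s1] /= /andP[eb _]; last by rewrite eb.
by apply/hasP; exists q.
Qed.

(** When a path is coloured backwards, the predecessor of each vertex is coloured after it; only the
    start [q] needs the hypothesis. *)
Lemma greedy_order_rev (Q : {set T}) c q s l :
  path e q s -> greedy_order Q c (q :: l) -> greedy_order Q c (rev (q :: s) ++ l).
Proof.
elim: s q l => [|q' s IH] q l //= /andP[qq' ep] Hq.
by rewrite rev_cons cat_rcons; apply: IH => //=; rewrite e_sym qq'; split; [left|].
Qed.

End ListColoring.

(** * Brooks' theorem for regular vertex-critical graphs *)

Section Brooks.

Variables (T C : finType) (e : rel T).
Hypotheses (e_sym : symmetric e) (e_irr : irreflexive e).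
Local Notation nbr := (nbr e).
Local Notation proper_on := (proper_on e).
Local Notation greedy_order := (greedy_order e).

Lemma maximal_path (Q : {set T}) p s :
  path e p s -> uniq (p :: s) -> {subset p :: s <= Q} ->
  exists t, [/\ path e p (s ++ t), uniq (p :: s ++ t), {subset p :: s ++ t <= Q} &
    {in Q, forall v, e (last p (s ++ t)) v -> v \in p :: s ++ t}].
Proof.
have [m] := ubnP (#|Q| - size s); elim: m s => // m IH s ltm ep us sQ.
case: (boolP [exists v in Q, e (last p s) v && (v \notin p :: s)]); last first.
  rewrite negb_exists_in => /forall_inP none; exists [::]; rewrite cats0.
  by split=> // v vQ lv; have := none v vQ; rewrite lv /= negbK.
case/exists_inP=> v vQ /andP[lv vs].
have lt : size s < #|Q|.
  have : #|[set x in p :: s]| <= #|Q|.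
    by apply/subset_leq_card/subsetP=> x; rewrite inE; apply: sQ.
  by rewrite cardsE (card_uniqP us).
have [||||t [t1 t2 t3 t4]] := IH (rcons s v).
- by rewrite size_rcons; lia.
- by rewrite rcons_path ep.
- by rewrite -rcons_cons rcons_uniq vs.
- by move=> x; rewrite -rcons_cons mem_rcons inE => /predU1P[->//|]; apply: sQ.
by exists (v :: t); rewrite -cat_rcons.
Qed.

Section Critical.

Variables (D : {set C}) (Q : {set T}).
Hypothesis regQ : {in Q, forall v, #|nbr v :&: Q| = #|D|}.
Hypothesis ncolQ : forall c, proper_on Q c -> {in Q, forall v, c v \in D} -> False.
Hypothesis critQ : {in Q, forall v, exists c,
  proper_on (Q :\ v) c /\ {in Q :\ v, forall u, c u \in D}}.
Hypothesis connQ : forall S : {set T}, S \subset Q -> S != set0 ->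
  {in S & Q, forall u v, e u v -> v \in S} -> Q \subset S.
Hypothesis D3 : 3 <= #|D|.

Lemma greedy_absurd (l : seq T) c :
  uniq l -> {subset l <= Q} ->
  proper_on (Q :\: [set s in l]) c -> {in Q :\: [set s in l], forall v, c v \in D} ->
  greedy_order (Q :\: [set s in l]) c l -> False.
Proof.
move=> ul lQ cP cD gl.
have [|c' [c'P c'D _]] := greedy_coloring e_sym e_irr ul lQ _ cP cD gl.
  by move=> s sl; rewrite regQ // lQ.
exact: ncolQ c'P c'D.
Qed.

(* Otherwise the neighbours of the last vertex close up a cycle avoiding some
   vertex of Q; going round that cycle from its last vertex we meet a vertex b
   with no neighbour outside followed by a vertex a having a neighbour u outside.
   Giving b the colour of u makes the cycle greedily colourable up to a. *)
Lemma maximal_path_spans p s :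
  path e p s -> uniq (p :: s) -> {subset p :: s <= Q} ->
  {in Q, forall v, e (last p s) v -> v \in p :: s} -> {subset Q <= p :: s}.
Proof.
move=> ep us sQ maxp; set z := last p s in maxp; set L := p :: s in us sQ maxp *.
have zL : z \in L by apply: mem_last.
have hasz : has (e z) L.
  have : 0 < #|nbr z :&: Q| by rewrite regQ ?sQ //; lia.
  case/card_gt0P=> v; rewrite !inE => /andP[zv vQ]; apply/hasP; exists v => //.
  exact: maxp.
(* The first neighbour [a] of [z] on the path: all neighbours of [z] then lie on the segment from
   [a] to [z], which the edge between [z] and [a] closes to a cycle. *)
set i := find (e z) L; pose a := nth p L i; pose L2 := drop i.+1 L.
have iL : i < size L by rewrite -has_find.
have dropE : drop i L = a :: L2 by rewrite (drop_nth p).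
have za : e z a by rewrite /a; apply: nth_find.
have pathL2 : path e a L2.
  have : sorted e (drop i L) by apply: drop_sorted.
  by rewrite dropE.
have lastL2 : last a L2 = z.
  have -> : last a L2 = last p (drop i L) by rewrite dropE.
  by rewrite -[z](last_cons p p s) -/L -[in RHS](cat_take_drop i L) last_cat dropE.
have uniqC : uniq (a :: L2) by rewrite -dropE drop_uniq.
have subC : {subset a :: L2 <= L} by move=> v; rewrite -dropE => /mem_drop.
have zC v : v \in Q -> e z v -> v \in a :: L2.
  move=> vQ zv; have := maxp v vQ zv; rewrite -{1}(cat_take_drop i L) mem_cat dropE.
  case/orP=> // /index_ltn lt; have := before_find p lt.
  by rewrite nth_index ?zv // maxp.
have [M [cycM uniqM memM]] : exists M, [/\ cycle e (z :: M), uniq (z :: M) &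
    z :: M =i a :: L2].
  case/lastP: L2 {dropE} pathL2 lastL2 uniqC {subC zC} => [|L3 y] pathL2 lastL2 uniqC.
    by move: za; rewrite -lastL2 e_irr.
  rewrite last_rcons in lastL2; subst y; exists (a :: L3).
  have -> : z :: a :: L3 = rotr 1 (a :: rcons L3 z) by rewrite -rcons_cons rotr1_rcons.
  split; last exact: mem_rotr.
    by rewrite rotr_cycle /= rcons_path pathL2 last_rcons.
  by rewrite rotr_uniq.
have MQ : {subset z :: M <= Q} by move=> v; rewrite memM => /subC /sQ.
pose f u := [exists v in Q, (v \notin z :: M) && e u v].
have fz : f z = false.
  apply/negbTE; rewrite negb_exists_in; apply/forall_inP=> v vQ.
  by rewrite memM; apply/negP => /andP[vC zv]; rewrite zC in vC.
(* If no vertex of the cycle has a neighbour in [Q] off the cycle, then by connectedness the cycle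
   is all of [Q]. *)
case: (boolP (has f M)) => [hasf|]; last first.
  move=> /hasPn nf v vQ; apply: subC; rewrite -memM.
  have : Q \subset [set u in z :: M].
    apply: connQ.
    - by apply/subsetP=> u; rewrite inE => /MQ.
    - by apply/set0Pn; exists z; rewrite inE mem_head.
    move=> u w; rewrite !inE => uM wQ uw; apply/negPn/negP => wM.
    have fu : f u by apply/exists_inP; exists w => //; rewrite inE wM uw.
    by case/predU1P: uM => [uz|/nf]; [rewrite uz fz in fu | rewrite fu].
  by move/subsetP/(_ v vQ); rewrite inE.
exfalso; have [M1 [a' [M2 [ME fa nfM1]]]] : exists M1 a' M2,
    [/\ M = M1 ++ a' :: M2, f a' & ~~ has f M1].
  by case: (split_find hasf) => a' M1 M2 fa nfM1; exists M1, a', M2; rewrite cat_rcons.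
pose b := last z M1; pose M3 := M2 ++ belast z M1.
have rotE : rot (size (z :: M1)) (z :: M) = rcons (a' :: M3) b.
  by rewrite ME -cat_cons rot_size_cat /M3 /= rcons_cat -lastI.
have nfb : f b = false.
  by have := mem_last z M1; rewrite inE -/b => /predU1P[->//|/(hasPn nfM1)/negbTE].
have memM3 v : (v \in rcons (a' :: M3) b) = (v \in z :: M) by rewrite -rotE mem_rot.
have : uniq (rcons (a' :: M3) b) by rewrite -rotE rot_uniq.
rewrite rcons_uniq => /andP[bM3 uniqM3].
have : cycle e (rcons (a' :: M3) b) by rewrite -rotE rot_cycle.
rewrite /= rcons_path last_rcons rcons_path => /andP[/andP[pathM3 _] eba].
have aM : a' \in z :: M by rewrite -memM3 mem_rcons !inE eqxx orbT.
have bM : b \in z :: M by rewrite -memM3 mem_rcons mem_head.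
have /exists_inP[u uQ /andP[uM au]] := fa.
have [c [cP cD]] := critQ (MQ a' aM).
pose l := rev (a' :: M3) ++ [::].
have lE v : (v \in l) = (v \in a' :: M3) by rewrite /l cats0 mem_rev.
have lM v : v \in l -> v \in z :: M.
  by rewrite lE -memM3 mem_rcons inE => ->; rewrite orbT.
have subl : Q :\: [set s in l] \subset Q :\ a'.
  by apply/setDS/subsetP=> v; rewrite !inE lE => /eqP->; rewrite mem_head.
have ub : u != b by apply: contraNneq uM => ->.
apply: (@greedy_absurd l (recolor c b (c u))).
- by rewrite /l cats0 rev_uniq.
- by move=> v /lM /MQ.
- apply: proper_on_recolor => //.
    by move=> v w /setD1P[_ vQ] /setD1P[_ wQ]; apply: cP; rewrite (subsetP subl).
  move=> v; rewrite 2!inE lE => /andP[vl vQ] vb bv.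
  suff : f b by rewrite nfb.
  apply/exists_inP; exists v => //.
  by rewrite bv andbT -memM3 mem_rcons inE (negbTE vb).
- move=> v vQ; case: (eqVneq v b) => [->|vb].
    rewrite recolor_same cD // !inE uQ andbT.
    by apply: contraNneq uM => ->.
  by rewrite recolor_other // cD // (subsetP subl).
apply: greedy_order_rev => //=; split=> //; right; exists u, b.
split=> //.
- by rewrite 2!inE uQ andbT; apply: contra uM => /lM.
- by rewrite 2!inE lE bM3 MQ.
- by rewrite e_sym.
by rewrite recolor_same recolor_other.
Qed.

(** Two non-adjacent neighbours [a], [b] of [x] may share a colour. The path a, x, b extends to one
    spanning [Q], and the other vertices can be coloured greedily with [x] last, since [x] sees the
    colour of [a] and [b] twice. *)
Lemma brooks_regular : {in Q & &, forall x a b, e x a -> e x b -> a != b -> e a b}.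
Proof.
move=> x a b xQ aQ bQ xa xb ab; apply/negPn/negP => nab.
have exs : e a x by rewrite e_sym.
have ax : a != x by apply: contraTneq xa => ->; rewrite e_irr.
have bx : b != x by apply: contraTneq xb => ->; rewrite e_irr.
have [|||t [pt ut tQ maxt]] := @maximal_path Q a [:: x; b].
- by rewrite /= exs xb.
- by rewrite /= !inE negb_or ax ab eq_sym bx.
- by move=> v; rewrite !inE => /or3P[] /eqP->.
have spanQ := maximal_path_spans pt ut tQ maxt.
have [q qt xq] : exists2 q, q \in t & e x q.
  have : 0 < #|(nbr x :&: Q) :\ a :\ b|.
    have := cardsD1 a (nbr x :&: Q); have := cardsD1 b ((nbr x :&: Q) :\ a).
    rewrite (regQ xQ); clear -D3.
    by case: (a \in _); case: (b \in _) => /=; lia.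
  case/card_gt0P=> q; rewrite !inE => /and4P[qb qa xq qQ]; exists q => //.
  have := spanQ q qQ; rewrite !inE (negbTE qa) (negbTE qb) /=.
  by case/predU1P => // qx; rewrite qx e_irr in xq.
have [d dD] : exists d, d \in D by apply/card_gt0P; apply: ltn_trans D3.
case/splitPr: qt pt ut tQ spanQ maxt => t1 t2 pt ut tQ spanQ _.
(* [q] is a third neighbour of [x]. Colour [t1] towards [q], then the tail of the path back to [q],
   which still has [x] uncoloured, and finally [x]. *)
pose l := t1 ++ (rev (q :: t2) ++ [:: x]).
have permL : perm_eq (a :: b :: l) (a :: [:: x; b] ++ t1 ++ q :: t2).
  rewrite perm_cons perm_sym /= -cat1s perm_catC /= perm_cons -catA.
  by rewrite perm_cat2l perm_cat2r perm_sym perm_rev.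
have memL := perm_mem permL.
have : uniq (a :: b :: l) by rewrite (perm_uniq permL).
rewrite 2!cons_uniq inE negb_or => /and3P[/andP[_ al] bl ul].
have lQ : {subset l <= Q}.
  by move=> v vl; apply: tQ; rewrite -memL !inE vl !orbT.
have restE v : v \in Q :\: [set s in l] -> (v == a) || (v == b).
  rewrite 2!inE => /andP[vl vQ]; have := spanQ v vQ.
  by rewrite -memL !inE (negbTE vl) orbF.
apply: (@greedy_absurd l (fun _ => d)) => //.
  move=> u v /restE/orP[]/eqP-> /restE/orP[]/eqP->; rewrite ?e_irr ?(negbTE nab) //.
  by rewrite e_sym (negbTE nab).
move: pt; rewrite /= => /and3P[_ _ pt].
apply: (greedy_order_path pt); first by rewrite mem_cat mem_rev mem_head.
move: pt; rewrite cat_path /= => /and3P[_ _ pt].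
apply: greedy_order_rev => //=; split; first by left; rewrite e_sym xq.
split=> //; right; exists a, b; split=> //.
- by rewrite 2!inE aQ andbT.
- by rewrite 2!inE bQ andbT.
Qed.

End Critical.

End Brooks.

(** * Partitioned colourings *)

Section Component.

Variables (T : finType) (e : rel T).
Hypothesis e_sym : symmetric e.
Implicit Types (W S : {set T}) (x y : T).

Definition closed_in (W S : {set T}) := {in S & W, forall u v, e u v -> v \in S}.

Definition rel_in (W : {set T}) : rel T := fun u v => [&& e u v, u \in W & v \in W].

Definition component (W : {set T}) (x : T) : {set T} := [set y | connect (rel_in W) x y].

Lemma rel_in_sym W : symmetric (rel_in W).
Proof. by move=> u v; rewrite /rel_in e_sym [(u \in W) && _]andbC. Qed.

Lemma mem_component W x : x \in component W x. Proof. by rewrite inE connect0. Qed.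

Lemma component_sub W x : x \in W -> component W x \subset W.
Proof.
move=> xW; apply/subsetP=> y; rewrite inE => /connectP[p ep ->].
by elim: p x xW ep => //= z p IH x _ /andP[/and3P[_ _ zW]]; apply: IH.
Qed.

Lemma component_closed W x : x \in W -> closed_in W (component W x).
Proof.
move=> xW u v uC vW uv; have uW := subsetP (component_sub xW) u uC.
move: uC; rewrite !inE => uC; apply: connect_trans uC (connect1 _).
by rewrite /rel_in uv uW.
Qed.

Lemma component_connected W x (S : {set T}) y :
  closed_in W S -> y \in S -> y \in component W x -> component W x \subset S.
Proof.
move=> clS yS; rewrite inE (sym_connect_sym (rel_in_sym W)) => yx.
apply/subsetP=> z; rewrite inE => /(connect_trans yx)/connectP[p ep ->].
elim: p y yS ep {yx} => //= z' p IH y yS /andP[/and3P[yz _ zW]].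
by apply: IH; apply: clS yz.
Qed.

End Component.

Section PartitionedColoring.

Variables (T C : finType) (e : rel T).
Hypotheses (e_sym : symmetric e) (e_irr : irreflexive e).
Hypothesis ncol : forall c : T -> C, ~ proper_on e setT c.
Local Notation nbr := (nbr e).
Local Notation proper_on := (proper_on e).
Implicit Types (P : {set C}) (c : T -> C).

(* The colourings below leave x uncoloured: the value c x is irrelevant. *)
Definition part P x c : {set T} := [set v | (v != x) && (c v \in P)].

(* Every edge is counted in both orientations. *)
Definition inner_edges P x c :=
  \sum_(u | u != x) \sum_(v | v != x) (e u v && ((c u \in P) == (c v \in P)) : nat).

Definition min_state P x c :=
  proper_on [set~ x] c /\
  forall x' c', proper_on [set~ x'] c' -> inner_edges P x c <= inner_edges P x' c'.

Lemma partC P x c : part (~: P) x c = ~: (x |: part P x c).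
Proof. by apply/setP=> v; rewrite !inE negb_or negb_and; case: (v == x). Qed.

Lemma inner_edgesC P x c : inner_edges (~: P) x c = inner_edges P x c.
Proof.
by apply: eq_bigr => u _; apply: eq_bigr => v _; rewrite !inE (inj_eq negb_inj).
Qed.

Lemma min_stateC P x c : min_state P x c -> min_state (~: P) x c.
Proof. by case=> cP cm; split=> // x' c' c'P; rewrite !inner_edgesC cm. Qed.

Lemma min_state_exists P x c : proper_on [set~ x] c -> exists x' c', min_state P x' c'.
Proof.
move=> cP; pose F (s : T * {ffun T -> C}) := inner_edges P s.1 s.2.
pose ok (s : T * {ffun T -> C}) :=
  [forall u in [set~ s.1], forall v in [set~ s.1], e u v ==> (s.2 u != s.2 v)].
have okP (s : T * {ffun T -> C}) : reflect (proper_on [set~ s.1] s.2) (ok s).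
  apply: (iffP forall_inP) => [H u v us vs|H u us].
    by move/forall_inP/(_ v vs)/implyP: (H u us).
  by apply/forall_inP=> v vs; apply/implyP; apply: H.
have ffunP0 y f : proper_on [set~ y] f -> ok (y, finfun f).
  by move=> fP; apply/okP=> u v us vs; rewrite /= !ffunE; apply: fP.
case: (arg_minnP F (ffunP0 _ _ cP)) => -[x' c'] /okP /= c'P c'm.
exists x', c'; split=> // y f fP; have := c'm _ (ffunP0 _ _ fP).
rewrite {2}/F /= => le; apply: leq_trans le _; apply: eq_leq.
by apply: eq_bigr => u _; apply: eq_bigr => v _; rewrite !ffunE.
Qed.

(** A colour missing around [x] could be given to [x], which would colour the whole graph. *)
Lemma nbr_hit x c i : proper_on [set~ x] c -> exists2 v, e x v & c v = i.
Proof.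
move=> cP; case: (boolP [exists v, e x v && (c v == i)]).
  by case/existsP=> v /andP[xv /eqP]; exists v.
rewrite negb_exists => /forallP none; case: (@ncol (recolor c x i)).
apply: proper_on_recolor => // [|v _ _ xv].
  by move=> u v; rewrite setTD; apply: cP.
by have := none v; rewrite xv.
Qed.

Lemma part_hit P x c : proper_on [set~ x] c -> P \subset c @: (nbr x :&: part P x c).
Proof.
move=> cP; apply/subsetP=> i iP; have [v xv cv] := nbr_hit i cP.
rewrite -cv; apply: imset_f; rewrite !inE xv cv iP andbT.
by apply: contraTneq xv => ->; rewrite e_irr.
Qed.

Lemma leq_part_nbr P x c : proper_on [set~ x] c -> #|P| <= #|nbr x :&: part P x c|.
Proof.
move=> cP; apply: leq_trans (subset_leq_card (part_hit P cP)) _.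
exact: leq_imset_card.
Qed.

(** Every colour of [P] occurs around [x] by [part_hit], so the cardinality says that each occurs
    exactly once. *)
Definition balanced P x c := min_state P x c /\ #|nbr x :&: part P x c| = #|P|.

Lemma balanced_inj P x c : balanced P x c -> {in nbr x :&: part P x c &, injective c}.
Proof.
move=> [[cP _] cd]; apply/imset_injP; rewrite eqn_leq leq_imset_card cd.
exact: subset_leq_card (part_hit P cP).
Qed.

(** The double sum ignores both [x] and [y], so it is unchanged when they exchange roles, and only
    the contribution of the coloured one has to be compared. The factor 2 comes from the two
    orientations. *)
Lemma inner_edges_split P x y c : y != x -> c y \in P ->
  inner_edges P x c =
    \sum_(u | (u != x) && (u != y)) \sum_(v | (v != x) && (v != y))
       (e u v && ((c u \in P) == (c v \in P)) : nat)
    + 2 * #|nbr y :&: part P x c|.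
Proof.
move=> yx cy; rewrite /inner_edges (bigD1 y) //=.
have degE : #|nbr y :&: part P x c| =
    \sum_(v | v != x) (e y v && ((c y \in P) == (c v \in P)) : nat).
  rewrite -sum1_card big_mkcond [RHS]big_mkcond; apply: eq_bigr => v _.
  by rewrite !inE cy; case: (v == x); case: (e y v); case: (c v \in P).
rewrite -degE; under [X in _ + X = _]eq_bigr => u ux do rewrite (bigD1 y) //=.
rewrite big_split /= addnA [RHS]addnC; congr (_ + _).
rewrite mul2n -addnn; congr (_ + _); rewrite degE [RHS](bigD1 y) //= e_irr /=.
by apply: eq_bigr => v _; rewrite e_sym [X in _ && X]eq_sym.
Qed.

Definition swap c x y := recolor c x (c y).

Lemma swap_part P x y c : y \in part P x c ->
  part P y (swap c x y) = x |: part P x c :\ y.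
Proof.
rewrite inE => /andP[yx cy]; apply/setP=> v; rewrite !inE /swap /recolor.
by case: (eqVneq v x) => [->|vx] /=; rewrite ?cy ?andbT // eq_sym.
Qed.

Lemma swap_partU P x y c : y \in part P x c ->
  y |: part P y (swap c x y) = x |: part P x c.
Proof.
move=> yU; rewrite swap_part //; apply/setP=> v; move: yU; rewrite !inE => /andP[yx cy].
by case: (eqVneq v y) => [->|vy] /=; rewrite ?yx ?cy ?orbT.
Qed.

(** The new colouring is proper because [y] is the only neighbour of [x] with its colour. Minimality
    bounds the number of neighbours of [y] in the part by [#|P|.-1], and [leq_part_nbr] after the
    exchange gives the converse; so the new state is again minimal and balanced. *)
Lemma balanced_swap P x y c :
  balanced P x c -> y \in nbr x :&: part P x c -> balanced P y (swap c x y).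
Proof.
move=> bal; have [[cP cm] cd] := bal; rewrite inE => /andP[]; rewrite nbrE => xy yU.
have [yx cy] : y != x /\ c y \in P by apply/andP; rewrite inE in yU.
have c'P : proper_on [set~ y] (swap c x y).
  apply: proper_on_recolor => // [u v|v].
    by rewrite !inE => /andP[ux _] /andP[vx _]; apply: cP; rewrite !inE.
  rewrite inE in_set1 => vy vx xv; apply: contraNneq vy => cvy.
  by apply/eqP; apply: (balanced_inj bal); rewrite // !inE ?xv ?xy ?vx ?yx ?cvy.
have c'x : swap c x y x \in P by rewrite /swap recolor_same.
have xx' : x != y by rewrite eq_sym.
have E1 := inner_edges_split yx cy; have E2 := inner_edges_split xx' c'x.
have dx : #|nbr x :&: part P y (swap c x y)| = #|P|.-1.
  rewrite -cd (cardsD1 y (nbr x :&: part P x c)) in_setI nbrE xy yU /=.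
  apply: eq_card => v; rewrite swap_part // !inE.
  by case: (eqVneq v x) => [->|vx]; rewrite ?e_irr /= ?andbF // andbCA.
have dy : #|nbr y :&: part P y (swap c x y)| = #|nbr y :&: part P x c|.+1.
  rewrite (cardsD1 x) swap_part // in_setI nbrE e_sym xy setU11 add1n.
  congr _.+1; apply: eq_card => v; rewrite !inE.
  by case: (eqVneq v x) => [->|vx]; rewrite ?andbF //=; case: eqVneq => [->|]; rewrite ?e_irr.
have main : forall f g : T -> T -> nat, (forall u v, u != x -> v != x -> f u v = g u v) ->
   \sum_(u | (u != x) && (u != y)) \sum_(v | (v != x) && (v != y)) f u v
   = \sum_(u | (u != y) && (u != x)) \sum_(v | (v != y) && (v != x)) g u v.
  move=> f g fg; apply: eq_big => [u|u /andP[ux _]]; first by rewrite andbC.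
  by apply: eq_big => [v|v /andP[vx _]]; [rewrite andbC | apply: fg].
rewrite (main _ (fun u v => e u v && ((swap c x y u \in P) == (swap c x y v \in P)) : nat))
  in E1; last by move=> u v ux vx; rewrite /swap !recolor_other.
have le := cm _ _ c'P; have ge := leq_part_nbr P c'P.
have P0 : 0 < #|P| by apply/card_gt0P; exists (c y).
split; last by lia.
by split=> // x' f fP; apply: leq_trans (cm _ _ fP); lia.
Qed.

Lemma balanced_reach P x y c :
  balanced P x c -> y \in component e (x |: part P x c) x ->
  exists c', [/\ balanced P y c', y |: part P y c' = x |: part P x c &
                 {in ~: (x |: part P x c), c' =1 c}].
Proof.
move=> bal; rewrite inE => /connectP[p ep ->].
elim: p x c bal ep => [|z p IH] x c bal /=; first by move=> _; exists c.
set W := x |: part P x c; case/andP=> /and3P[xz _ zW] ep.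
have zU : z \in part P x c.
  by move: zW; rewrite !inE => /predU1P[zx|//]; rewrite zx e_irr in xz.
have balz : balanced P z (swap c x z) by apply: balanced_swap; rewrite // inE nbrE xz.
have WE := swap_partU zU.
have [|c' [b' W' E']] := IH z (swap c x z) balz; first by rewrite WE.
exists c'; split=> //; first by rewrite W' WE.
move=> v vW; rewrite E' ?WE // /swap recolor_other //.
by apply: contraTneq vW => ->; rewrite !inE eqxx.
Qed.

(** Exchanges along a path make [y] the uncoloured vertex without changing the set
    [x |: part P x c], and a balanced vertex has [#|P|] neighbours there. *)
Lemma balanced_degree P x y c :
  balanced P x c -> y \in component e (x |: part P x c) x ->
  #|nbr y :&: (x |: part P x c)| = #|P|.
Proof.
move=> bal /(balanced_reach bal)[c' [[_ <-] <- _]]; apply: eq_card => v.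
by rewrite !inE; case: (eqVneq v y) => [->|//]; rewrite e_irr.
Qed.

(** Edges leaving the component end in colours outside [P], so [c0] on the component and [c]
    elsewhere would colour the whole graph. *)
Lemma component_not_colorable P x c c0 :
  proper_on [set~ x] c -> proper_on (component e (x |: part P x c) x) c0 ->
  {in component e (x |: part P x c) x, forall v, c0 v \in P} -> False.
Proof.
set Q := component _ _ _ => cP c0P c0D.
have xW : x \in x |: part P x c by rewrite setU11.
have xQ : x \in Q by apply: mem_component.
have cross u v : u \in Q -> v \notin Q -> e u v -> c v \notin P.
  move=> uQ vQ uv; apply: contra vQ => cv; apply: (component_closed xW uQ) => //.
  by rewrite !inE cv andbT orbN.
case: (@ncol (fun v => if v \in Q then c0 v else c v)) => u v _ _ uv.
case: (boolP (u \in Q)) => uQ; case: (boolP (v \in Q)) => vQ.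
- exact: c0P.
- by apply: contraNneq (cross _ _ uQ vQ uv) => <-; apply: c0D.
- by apply: contraNneq (cross _ _ vQ uQ _) => [->|]; rewrite ?c0D // e_sym.
by apply: cP; rewrite ?inE //; [apply: contraNneq uQ | apply: contraNneq vQ] => ->.
Qed.

(** The component of [x] is [#|P|]-regular, not colourable from [P], and becomes so when any one
    vertex is left out, by [balanced_reach]; thus Brooks' theorem applies. *)
Lemma balanced_clique P x c : 3 <= #|P| -> balanced P x c ->
  {in nbr x :&: part P x c &, forall a b, a != b -> e a b}.
Proof.
move=> P3 bal a b aA bA ab; have [[cP _] _] := bal.
set W := x |: part P x c; pose Q := component e W x.
have xW : x \in W by rewrite setU11.
have xQ : x \in Q by apply: mem_component.
have QE v : v \in Q -> nbr v :&: Q = nbr v :&: W.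
  move=> vQ; apply/setP=> u; rewrite !in_setI nbrE; case: (boolP (e v u)) => //= vu.
  apply/idP/idP=> [/(subsetP (component_sub _ xW))//|uW].
  exact: component_closed vQ uW vu.
have AQ v : v \in nbr x :&: part P x c -> v \in Q.
  case/setIP; rewrite nbrE => xv vU; apply: component_closed xv => //.
  by rewrite in_setU1 vU orbT.
have [xa xb] : e x a /\ e x b by move: aA bA; rewrite !inE => /andP[-> _] /andP[-> _].
apply: (brooks_regular (D := P) (Q := Q) e_sym e_irr _ _ _ _ P3 xQ) => //; try exact: AQ.
- by move=> v vQ; rewrite QE //; apply: balanced_degree.
- by move=> c0; apply: component_not_colorable.
- move=> v vQ; have [c' [[[c'P _] _] WE _]] := balanced_reach bal vQ.
  exists c'; split=> [u w|u] /setD1P[uv uQ].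
    by case/setD1P=> wv _; apply: c'P; rewrite !inE.
  by have := subsetP (component_sub _ xW) u uQ; rewrite /W -WE !inE (negbTE uv).
move=> S sSQ /set0Pn[v vS] clS; apply: (component_connected e_sym (y := v)) => //.
  move=> u w uS wW uw; apply: (clS u w uS _ uw).
  exact: (component_closed xW (subsetP sSQ u uS) wW uw).
exact: (subsetP sSQ).
Qed.

(** A neighbour [a] of [x] in the part already has [#|P|] neighbours, namely [x] and the rest of the
    clique; a further one would break regularity. *)
Lemma balanced_nbr_closed P x c : 3 <= #|P| -> balanced P x c ->
  closed_in e (part P x c) (nbr x :&: part P x c).
Proof.
move=> P3 bal a b aA bU ab; apply/negPn/negP => bA.
have xW : x \in x |: part P x c by rewrite setU11.
have aQ : a \in component e (x |: part P x c) x.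
  case/setIP: (aA); rewrite nbrE => xa aU; apply: component_closed (mem_component _ _ _) _ xa => //.
  by rewrite in_setU1 aU orbT.
have := balanced_degree bal aQ; have [_ <-] := bal.
set A := nbr x :&: _ in aA bA *; move/eqP; apply/negP; rewrite neq_ltn; apply/orP; right.
have xa : e x a by case/setIP: aA; rewrite nbrE.
have xb : x != b by apply: contraTneq bU => ->; rewrite !inE eqxx.
have xA : x \notin A by rewrite !inE e_irr.
have -> : #|A| = #|x |: (A :\ a)| by rewrite cardsU1 !inE e_irr andbF (cardsD1 a) aA.
have bx : b \notin x |: (A :\ a).
  by rewrite in_setU1 in_setD1 (negbTE bA) andbF orbF eq_sym.
apply: leq_trans (_ : #|b |: (x |: (A :\ a))| <= _); first by rewrite [in X in _ <= X]cardsU1 bx.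
apply/subset_leq_card/subsetP=> v; rewrite in_setI nbrE.
case/setU1P=> [->|/setU1P[->|/setD1P[va vA]]].
- by rewrite ab in_setU1 bU orbT.
- by rewrite e_sym xa setU11.
rewrite (balanced_clique P3 bal aA vA) 1?eq_sym //=.
by rewrite in_setU1; case/setIP: vA => _ ->; rewrite orbT.
Qed.

(* If S missed a neighbour of x, exchanging the two colours on S would free a
   colour at x. *)
Lemma balanced_kempe P x c (S : {set T}) : #|P| = 2 -> balanced P x c ->
  S \subset part P x c -> closed_in e (part P x c) S ->
  nbr x :&: S != set0 -> nbr x :&: part P x c \subset S.
Proof.
move=> P2 bal sS clS /set0Pn[p /setIP[]]; rewrite nbrE => xp pS.
apply/subsetP=> q qA; apply/negPn/negP => qS; have [[cP _] _] := bal.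
have /setIP[xq qU] := qA; rewrite nbrE in xq.
have pA : p \in nbr x :&: part P x c by rewrite in_setI nbrE xp (subsetP sS).
have pq : p != q by apply: contraNneq qS => <-.
have cpq : c p != c q by apply: contra_neq pq; apply: (balanced_inj bal).
have inP v : v \in part P x c -> c v \in P by rewrite inE => /andP[].
have PE : P = [set c p; c q].
  apply/esym/eqP; rewrite eqEcard cards2 cpq P2 leqnn andbT subUset !sub1set.
  by rewrite !inP // (subsetP sS).
pose c' v := if v \in S then (if c v == c p then c q else c p) else c v.
have c'P : proper_on [set~ x] c'.
  move=> u v ux vx uv; have cuv := cP u v ux vx uv; rewrite /c'.
  have cross w z : w \in S -> z \notin S -> z \in [set~ x] -> e w z -> c z \notin P.
    move=> wS zS; rewrite !inE => zx wz; apply: contra zS => cz.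
    by apply: clS wz; rewrite // inE zx.
  case: (boolP (u \in S)) => uS; case: (boolP (v \in S)) => vS //.
  - have := inP u (subsetP sS u uS); have := inP v (subsetP sS v vS).
    rewrite PE !inE => /orP[]/eqP cv /orP[]/eqP cu; move: cuv;
      by rewrite cu cv ?[c q == c p]eq_sym ?eqxx ?(negbTE cpq) ?eqxx //= eq_sym.
  - have := cross u v uS vS vx uv; rewrite PE !inE negb_or => /andP[vp vq].
    by case: ifP => _; rewrite eq_sym.
  have := cross v u vS uS ux; rewrite e_sym => /(_ uv).
  by rewrite PE !inE negb_or => /andP[vp vq]; case: ifP.
(* After the exchange no neighbour of [x] can have the colour of [p]: inside [S] it would have to be
   [q], outside [S] it would have to be [p]. *)
have [v xv c'v] := nbr_hit (c p) c'P.
have cvP : c v \in P.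
  move: c'v; rewrite /c'; case: ifP => [vS _|_ ->]; first by apply/inP/(subsetP sS).
  by apply/inP/(subsetP sS).
have vA : v \in nbr x :&: part P x c.
  by rewrite !inE xv cvP andbT; apply: contraTneq xv => ->; rewrite e_irr.
move: c'v; rewrite /c'; case: ifP => vS.
  move: cvP; rewrite PE !inE; case/orP=> /eqP cv; rewrite cv ?eqxx.
    by move/esym/eqP; rewrite (negbTE cpq).
  by move=> _; move: qS; rewrite -(balanced_inj bal vA qA cv) vS.
by move=> cv; move: vS; rewrite (balanced_inj bal vA pA cv) pS.
Qed.

End PartitionedColoring.

(** * The walk of the uncoloured vertex *)

Section Critical.

Variables (T C : finType) (e : rel T) (P : {set C}).
Hypotheses (e_sym : symmetric e) (e_irr : irreflexive e).
Hypothesis ncol : forall c : T -> C, ~ proper_on e setT c.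
Hypotheses (P2 : #|P| = 2) (C5 : 5 <= #|C|).
Local Notation nbr := (nbr e).
Local Notation component := (component e).
Local Notation closed_in := (closed_in e).

Implicit Types (c : T -> C) (Q : {set C}) (x y : T) (V S : {set T}).

Definition low x := #|nbr x| == #|C|.

Hypothesis low_or_high : forall x, low x \/ #|nbr x| = #|C|.+1.
Hypothesis high_indep : forall x y, e x y -> low x || low y.

Definition clique (X : {set T}) := {in X &, forall a b, a != b -> e a b}.

(* Of a minimal colouring only the uncoloured vertex x and the vertex set V of
   the two-coloured part are remembered; outside x V is the other part. *)
Definition state x V :=
  low x /\ exists2 c : T -> C, min_state e P x c & V = part P x c.

Definition outside x V : {set T} := ~: (x |: V).

Lemma PC3 : 3 <= #|~: P|. Proof. by have := cardsC P; lia. Qed.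

(** The [#|C|] neighbours of [x] split into at least [#|Q|] and at least [#|~: Q|], so both bounds
    are attained. *)
Lemma low_balanced Q x c : min_state e Q x c -> low x -> balanced e Q x c.
Proof.
move=> ms /eqP lx; split=> //; have [cP _] := ms.
have g1 := leq_part_nbr e_sym e_irr ncol Q cP.
have g2 := leq_part_nbr e_sym e_irr ncol (~: Q) cP.
have := cardsID (part Q x c) (nbr x); rewrite lx -(cardsC Q).
have -> : nbr x :\: part Q x c = nbr x :&: part (~: Q) x c.
  apply/setP=> v; rewrite !inE negb_and.
  by case: (eqVneq v x) => [->|vx]; rewrite ?e_irr // andbC.
lia.
Qed.

(** A high uncoloured vertex has only one neighbour too many, so it is balanced in one of the two
    parts. Exchanging it with a neighbour there uncolours a vertex that is low, high vertices being
    independent. *)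
Lemma state_exists x c : proper_on e [set~ x] c -> exists x' V, state x' V.
Proof.
case/(min_state_exists P) => {}x [{}c ms].
have [lx|hx] := low_or_high x; first by exists x, (part P x c); split=> //; exists c.
have [cP _] := ms.
suff [Q [bal Q0 ms']] : exists Q, [/\ balanced e Q x c, 0 < #|Q| &
    forall y c', min_state e Q y c' -> min_state e P y c'].
  have /card_gt0P[y yA] : 0 < #|nbr x :&: part Q x c| by case: bal => _ ->.
  have [/ms' msy _] := balanced_swap e_sym e_irr ncol bal yA.
  exists y, (part P y (swap c x y)); split; last by exists (swap c x y).
  have xy : e x y by move: yA; rewrite inE nbrE => /andP[].
  by have := high_indep xy; rewrite /low hx; case: eqP => //; lia.
have g1 := leq_part_nbr e_sym e_irr ncol P cP.
have g2 := leq_part_nbr e_sym e_irr ncol (~: P) cP.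
have := cardsID (part P x c) (nbr x); rewrite hx -(cardsC P).
have -> : nbr x :\: part P x c = nbr x :&: part (~: P) x c.
  apply/setP=> v; rewrite !inE negb_and.
  by case: (eqVneq v x) => [->|vx]; rewrite ?e_irr // andbC.
move=> E; have [E1|E2] : #|nbr x :&: part P x c| = #|P| \/
    #|nbr x :&: part (~: P) x c| = #|~: P| by lia.
  by exists P; split=> //; rewrite P2.
exists (~: P); split; first by split=> //; apply: min_stateC.
  by have := PC3; lia.
by move=> y c' /min_stateC; rewrite setCK.
Qed.

(** * Neighbourhoods and exchanges in a fixed state *)

Section State.

Variables (x : T) (V : {set T}).
Hypothesis sx : state x V.

Lemma state_notin : x \notin V.
Proof. by have [_ [c _ ->]] := sx; rewrite inE eqxx. Qed.

Lemma state_outside : exists2 c : T -> C, balanced e (~: P) x c &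
  outside x V = part (~: P) x c.
Proof.
have [lx [c ms ->]] := sx; exists c; last by rewrite partC.
by apply: low_balanced lx; apply: min_stateC.
Qed.

Lemma card_outside_nbr : #|nbr x :&: outside x V| = #|~: P|.
Proof. by have [c [_ <-] ->] := state_outside. Qed.

Lemma outside_nbr_clique : clique (nbr x :&: outside x V).
Proof.
have [c bal ->] := state_outside.
exact (balanced_clique e_sym e_irr ncol PC3 bal).
Qed.

Lemma outside_nbr_closed : closed_in (outside x V) (nbr x :&: outside x V).
Proof.
have [c bal ->] := state_outside.
exact (balanced_nbr_closed e_sym e_irr ncol PC3 bal).
Qed.

(** The exchange takes place in the other part, so the two-coloured part keeps its vertex set. *)
Lemma state_swap z : z \in nbr x :&: outside x V -> low z -> state z V.
Proof.
have [lx [c ms VE]] := sx; have bal := low_balanced (min_stateC ms) lx.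
rewrite VE /outside -partC => zA lz; split=> //; exists (swap c x z).
  have [/min_stateC] := balanced_swap e_sym e_irr ncol bal zA.
  by rewrite setCK.
have E y c' : part P y c' = ~: (y |: part (~: P) y c') by rewrite -partC setCK.
by rewrite E [RHS]E swap_partU //; move: zA; rewrite inE => /andP[].
Qed.

Lemma state_reach y : y \in component (x |: V) x -> low y -> state y ((x |: V) :\ y).
Proof.
have [lx [c ms VE]] := sx; have bal := low_balanced ms lx.
rewrite VE => yQ ly; split=> //.
have [c' [[ms' _] W' _]] := balanced_reach e_sym e_irr ncol bal yQ.
exists c' => //; rewrite -W'; apply/setP=> v; rewrite !inE.
by case: (eqVneq v y).
Qed.

Lemma state_degree y : y \in component (x |: V) x -> #|nbr y :&: (x |: V)| = 2.
Proof.
have [lx [c ms VE]] := sx; have bal := low_balanced ms lx.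
by rewrite VE -P2; apply: balanced_degree.
Qed.

Lemma state_kempe (S : {set T}) : S \subset V -> closed_in V S ->
  nbr x :&: S != set0 -> nbr x :&: V \subset S.
Proof.
have [lx [c ms VE]] := sx; have bal := low_balanced ms lx.
by rewrite VE; apply: balanced_kempe bal.
Qed.

(* If every edge of the component had a high end, then colouring it by low and
   high would be proper. *)
Lemma state_low_edge : exists w y,
  [/\ w \in component (x |: V) x, y \in component (x |: V) x, e w y, low w & low y].
Proof.
have [lx [c [cP _] VE]] := sx.
case: (boolP [exists w in component (x |: V) x, exists y in component (x |: V) x,
    [&& e w y, low w & low y]]).
  by case/exists_inP=> w wQ /exists_inP[y yQ /and3P[wy lw ly]]; exists w, y.
move=> /exists_inPn none; exfalso.
have /cards2P[i [j [ij PE]]] : #|P| == 2 by rewrite P2.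
apply: (@component_not_colorable _ _ _ e_sym ncol P x c (fun v => if low v then i else j)) => //.
  move=> u v; rewrite -VE => uQ vQ uv.
  have := none u uQ; rewrite negb_exists_in => /forall_inP/(_ v vQ); rewrite uv /=.
  have := high_indep uv; case: (low u); case: (low v) => //= _ _; by rewrite eq_sym.
by move=> v _; rewrite PE !inE; case: (low v); rewrite eqxx ?orbT.
Qed.

Lemma mem_component_nbr y : y \in V -> e x y -> y \in component (x |: V) x.
Proof.
move=> yV xy; apply: (component_closed (setU11 x V) (mem_component e _ x)) xy.
by rewrite in_setU1 yV orbT.
Qed.

Lemma state_nbr_pair y : y \in V -> e x y ->
  exists z, [/\ z \in V, e x z, z != y & nbr x :&: V = [set y; z]].
Proof.
move=> yV xy; have := state_degree (mem_component e _ x).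
have -> : nbr x :&: (x |: V) = nbr x :&: V.
  by apply/setP=> v; rewrite !inE; case: (eqVneq v x) => [->|]; rewrite ?e_irr.
have yA : y \in nbr x :&: V by rewrite in_setI nbrE xy.
rewrite (cardsD1 y) yA => -[] /eqP/cards1P[z zE].
have : z \in (nbr x :&: V) :\ y by rewrite zE set11.
rewrite in_setD1 in_setI nbrE => /and3P[zy xz zV]; exists z; split=> //.
by rewrite -zE setD1K.
Qed.

Lemma component_minus_closed : closed_in V (component (x |: V) x :\ x).
Proof.
move=> u v /setD1P[ux uQ] vV uv; rewrite in_setD1; apply/andP; split.
  by apply: contraNneq state_notin => <-.
by apply: (component_closed (setU11 x V) uQ) uv; rewrite in_setU1 vV orbT.
Qed.

End State.

(** * Adjacent low vertices with common outside neighbours *)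

Lemma outside_reach x V y : y \in x |: V -> outside y ((x |: V) :\ y) = outside x V.
Proof.
move=> yW; rewrite /outside; congr (~: _); apply/setP=> v; rewrite !inE.
by case: (eqVneq v y) => [->|]; rewrite //= -in_setU1 yW.
Qed.

Lemma clique_low_mem (X : {set T}) h a : clique X -> h \in X -> a \in X ->
  ~~ low h -> a != h -> low a.
Proof.
by move=> clX hX aX hh ah; have := high_indep (clX a h aX hX ah); rewrite (negbTE hh) orbF.
Qed.

Lemma clique_has_low (X : {set T}) : clique X -> 2 <= #|X| -> exists2 a, a \in X & low a.
Proof.
move=> clX /card_gt1P[a [b [aX bX ab]]].
case: (boolP (low a)) => la; first by exists a.
by exists b => //; apply: (clique_low_mem clX aX bX la); rewrite eq_sym.
Qed.

(** By [state_kempe] at [x], the component of [a] contains every neighbour [v] of [x] in [V]. Such a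
    [v] has degree 2 both in [x |: V] and in [a |: V]; since it is adjacent to [x], it must be
    adjacent to [a]. *)
Lemma state_same_inside x a V u : state x V -> state a V ->
  u \in V -> e x u -> e a u -> nbr x :&: V \subset nbr a.
Proof.
move=> sx sa uV xu au; have xV := state_notin sx; have aV := state_notin sa.
have sub : nbr x :&: V \subset component (a |: V) a :\ a.
  apply: (state_kempe sx) (component_minus_closed sa) _.
    apply/subsetP=> v /setD1P[va /(subsetP (component_sub _ (setU11 _ _)))].
    by rewrite in_setU1 (negbTE va).
  apply/set0Pn; exists u; rewrite in_setI in_setD1 nbrE xu (mem_component_nbr uV au) andbT.
  by apply: contraNneq aV => <-.
apply/subsetP=> v vA; have /setIP[] := vA; rewrite nbrE => xv vV; rewrite nbrE.
have /setD1P[_ vQ] := subsetP sub v vA.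
have d1 := state_degree sa vQ; have d2 := state_degree sx (mem_component_nbr vV xv).
apply/negPn/negP => av; move: d2; rewrite -d1 (cardsD1 x) in_setI nbrE e_sym xv setU11.
have -> : (nbr v :&: (x |: V)) :\ x = nbr v :&: (a |: V).
  apply/setP=> z; rewrite !inE; case: (eqVneq z x) => [->|zx] /=.
    rewrite (negbTE xV) orbF; case: (eqVneq x a) => [xa|]; last by rewrite andbF.
    by rewrite -xa xv in av.
  by case: (eqVneq z a) => [->|//]; rewrite e_sym (negbTE av) (negbTE aV).
by move/eqP; rewrite /= add1n eqn_leq ltnn.
Qed.

Lemma twins_greedy_order (R : {set T}) c (l : seq T) :
  {in l, forall s, twin_nbrs e R c s} -> greedy_order e R c l.
Proof.
elim: l => //= s l IH H; split; first by right; apply: H; rewrite mem_head.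
by apply: IH => v vl; apply: H; rewrite inE vl orbT.
Qed.

(* h and z receive a common colour, avoiding their at most four neighbours
   outside S; then every vertex of S sees that colour twice. *)
Lemma no_almost_clique x c (S : {set T}) h z :
  proper_on e [set~ x] c -> x \in S -> {in S, forall s, low s} -> #|S|.+1 = #|C| ->
  h \notin S -> z \notin S -> h != z -> ~~ e h z ->
  {in S, forall s, e s h} -> {in S, forall s, e s z} -> False.
Proof.
move=> cP xS lowS cardS hS zS hz nhz Sh Sz.
have outer v : {in S, forall s, e s v} -> #|nbr v :\: S| <= 2.
  move=> Sv; have sub : S \subset nbr v.
    by apply/subsetP=> s sS; rewrite nbrE e_sym Sv.
  have := cardsID S (nbr v); rewrite (setIidPr sub).
  have : #|nbr v| <= #|C|.+1.
    by case: (low_or_high v) => [/eqP|] ->; rewrite ?leqnSn.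
  lia.
pose F := c @: ((nbr z :|: nbr h) :\: S).
have [i _ iF] : exists2 i, i \in [set: C] & i \notin F.
  apply/subsetPn/negP => /subset_leq_card; rewrite cardsT => le.
  have := leq_imset_card c (pred_of_set ((nbr z :|: nbr h) :\: S)); rewrite -/F.
  have := outer z Sz; have := outer h Sh.
  rewrite setDUl cardsU; lia.
have Fv v : v \notin S -> (e z v) || (e h v) -> c v != i.
  move=> vS zhv; apply: contraNneq iF => <-; apply: imset_f.
  by rewrite in_setD vS in_setU !nbrE.
pose c1 := recolor (recolor c z i) h i.
pose l := enum S; have lE : [set s in l] = S by apply/setP=> v; rewrite inE mem_enum.
have xz v : v \notin S -> v \in [set~ x].
  by move=> vS; rewrite !inE; apply: contraNneq vS => ->.
have [||||||c' [c'P _ _]] := @greedy_coloring T C e e_sym e_irr [set: C] setT l c1.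
- exact: enum_uniq.
- by move=> s _; rewrite inE.
- move=> s; rewrite mem_enum setIT cardsT => /lowS/eqP ->; exact: leqnn.
- rewrite lE; apply: proper_on_recolor => //.
    apply: proper_on_recolor => // [u v|v].
      rewrite !inE !andbT => /and3P[_ _ uS] /and3P[_ _ vS]; apply: cP; exact: xz.
    by rewrite !inE andbT => /andP[_ vS] _ zv; apply: Fv; rewrite ?zv.
  move=> v; rewrite !inE andbT => vS vh hv.
  rewrite recolor_other; first by apply: Fv; rewrite ?hv ?orbT.
  by apply: contraNneq nhz => <-.
- by move=> v _; rewrite inE.
- rewrite lE; apply: twins_greedy_order => s; rewrite mem_enum => sS.
  exists z, h; split; rewrite ?inE ?Sz ?Sh //; first by rewrite zS.
    by rewrite hS.
  rewrite eq_sym; split; first by [].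
  by rewrite /c1 recolor_same recolor_other 1?eq_sym // recolor_same.
exact: ncol c'P.
Qed.

Lemma common_outside_clique w V y : state w V -> y \in V -> e w y -> low y ->
  nbr w :&: outside w V = nbr y :&: outside w V ->
  exists2 X : {set T}, #|X| = #|C|.+1 & clique X.
Proof.
move=> sw yV wy ly; set A := nbr w :&: _ => AE.
have wV := state_notin sw; have [lw _] := sw.
have yw : y != w by apply: contraNneq wV => <-.
have yQ := mem_component_nbr yV wy.
have yW : y \in w |: V by rewrite in_setU1 yV orbT.
set V' := (w |: V) :\ y.
have sy : state y V' by apply: state_reach.
have outE : outside y V' = outside w V by apply: outside_reach.
have wV' : w \in V' by rewrite in_setD1 eq_sym yw setU11.
have [z [zV wz zy NwE]] := state_nbr_pair sw yV wy.
have yw' : e y w by rewrite e_sym.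
have [z' [z'V' yz' z'w NyE]] := state_nbr_pair sy wV' yw'.
have clA : clique A := outside_nbr_clique sw.
have cardA : #|A| = #|~: P| := card_outside_nbr sw.
have aw a : a \in A -> e a w by rewrite in_setI nbrE e_sym => /andP[].
have ay a : a \in A -> e a y by rewrite AE in_setI nbrE e_sym => /andP[].
have Aout a : a \in A -> a \notin w |: V by rewrite in_setI in_setC => /andP[].
(* A low [a] can be uncoloured instead of [w]; it shares the inner neighbour [y] with [w], hence
   also [z]. *)
have az a : a \in A -> low a -> e a z.
  move=> aA la; have sa := state_swap sw aA la.
  rewrite -nbrE; apply: (subsetP (state_same_inside sw sa yV wy (ay a aA))).
  by rewrite in_setI nbrE wz.
have az' a : a \in A -> low a -> e a z'.
  move=> aA la; have sa : state a V' by apply: (state_swap sy) la; rewrite outE -AE.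
  rewrite -nbrE; apply: (subsetP (state_same_inside sy sa wV' yw' (aw a aA))).
  by rewrite in_setI nbrE yz'.
have C3 := PC3; have CP := cardsC P.
have [a0 a0A la0] : exists2 a, a \in A & low a by apply: (clique_has_low clA); rewrite cardA ltnW.
clearbody A; have zw : z != w by apply: contraNneq wV => <-.
have [z'W z'y] : z' \in w |: V /\ z' != y by case/setD1P: z'V'.
have zW : z \in w |: V by rewrite in_setU1 zV orbT.
have wW : w \in w |: V by rewrite setU11.
(* Otherwise the low vertex [a0] would be adjacent to [w], [y], [z], [z'] and the rest of [A], which
   makes [#|C|.+1] neighbours. *)
have z'z : z' = z.
  apply/eqP/negPn/negP => neq; pose s := [:: w; y; z; z'].
  have us : uniq s by rewrite /= !inE !negb_or ![_ == z']eq_sym neq z'w z'y ![_ == z]eq_sym zw zy eq_sym yw.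
  have sW v : v \in s -> v \in w |: V by rewrite !inE => /or4P[]/eqP->; move: wW yW zW z'W; rewrite !inE.
  have sub : (A :\ a0) :|: [set v in s] \subset nbr a0.
    apply/subsetP=> v; rewrite nbrE; case/setUP=> [/setD1P[va vA]|].
      by apply: clA; rewrite // eq_sym.
    rewrite !inE => /or4P[]/eqP->; [exact: aw | exact: ay | exact: az | exact: az'].
  have dis : (A :\ a0) :&: [set v in s] = set0.
    apply/setP=> v; rewrite in_set0; apply/negbTE/negP => /setIP[/setD1P[_ /Aout/negP vA]].
    by rewrite inE => /sW.
  have card4 : #|[set v in s]| = 4 by rewrite cardsE (card_uniqP us).
  have := subset_leq_card sub; rewrite cardsU dis cards0 subn0 card4 (eqP la0).
  have := cardsD1 a0 A; rewrite a0A cardA; clear -CP P2; lia.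
subst z'; have yz : e y z by [].
have zA : z \notin A by apply: contraL zW => /Aout.
have X3 : #|[set w; y; z]| = 3.
  by rewrite -setUA cardsU1 cards2 !inE negb_or ![w == _]eq_sym yw zw eq_sym zy.
case: (boolP [forall a in A, e a z]) => [/forall_inP allz|].
  exists ([set w; y; z] :|: A).
    have -> : #|C| = #|A| + 2 by rewrite cardA -CP P2 addnC.
    rewrite cardsU X3; have -> : [set w; y; z] :&: A = set0.
      apply/setP=> v; rewrite in_set0; apply/negbTE/negP => /setIP[vX /Aout/negP]; apply.
      by move: vX; rewrite !in_setU !in_set1 -!orbA => /or3P[]/eqP->; rewrite ?eqxx ?yV ?zV ?orbT.
    by rewrite cards0 subn0 addnC addn3 addn2.
  have adjA a v : a \in A -> v \in [set w; y; z] -> e a v.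
    by move=> aA; rewrite !inE -orbA => /or3P[]/eqP->; auto.
  move=> u v /setUP[uX|uA] /setUP[vX|vA] uv.
  - move: uX vX uv; rewrite !inE -!orbA.
    by case/or3P=> /eqP-> /or3P[]/eqP->; rewrite ?eqxx // e_sym.
  - by rewrite e_sym adjA.
  - exact: adjA.
  exact: clA.
(* Such an [h] is high, so the rest of the clique [A] is low. Together with [w] and [y] it forms a
   set of [#|C|.-1] low vertices joined to both [h] and [z]. *)
rewrite negb_forall_in => /exists_inP[h hA nhz]; exfalso.
have hh : ~~ low h by apply: contra nhz; apply: az.
have lowA a : a \in A :\ h -> low a.
  by case/setD1P=> ah aA; apply: (clique_low_mem clA hA aA hh).
have [c [cP _] _] := sw.2.
apply: (@no_almost_clique w c ([set w; y] :|: (A :\ h)) h z cP) => //.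
- by rewrite !inE eqxx.
- by move=> s /setUP[|/lowA//]; rewrite !inE => /orP[]/eqP->.
- rewrite cardsU; have -> : [set w; y] :&: (A :\ h) = set0.
    apply/setP=> v; rewrite in_set0; apply/negbTE/negP => /setIP[vX /setD1P[_ /Aout/negP]]; apply.
    by move: vX; rewrite !inE => /orP[]/eqP->; rewrite ?eqxx ?yV ?orbT.
  by rewrite cards0 cards2 eq_sym yw; have := cardsD1 h A; rewrite hA cardA; clear -CP P2; lia.
- rewrite in_setU in_setD1 eqxx orbF; apply: contra (Aout h hA).
  by rewrite !inE => /orP[]/eqP->; rewrite ?eqxx ?yV ?orbT.
- by rewrite in_setU in_setD1 (negbTE zA) andbF orbF !inE negb_or zw zy.
- by apply: contraNneq zA => <-.
- move=> s /setUP[|/setD1P[sh sA]]; last exact: clA.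
  by rewrite !inE => /orP[]/eqP->; rewrite e_sym; auto.
move=> s /setUP[|sA]; last by apply: az (lowA _ sA); case/setD1P: sA.
by rewrite !inE => /orP[]/eqP->.
Qed.
(** [A] is a union of components of [W] that misses [y]. So when [Y] lies in [W], the vertex [w] has
    neighbours in two different components of [W]. *)
Definition locked (W Y : {set T}) w :=
  low w /\ exists y (A : {set T}),
    [/\ y \in Y :\: A, e w y, A \subset W :&: nbr w, A != set0 & closed_in W A].

(* R collects the inside components already traversed by the walk of the
   uncoloured vertex, and Y the vertices through which it left them. *)
Record walk x V (R Y : {set T}) : Prop := Walk {
  walk_state : state x V;
  walk_sub : R \subset V;
  walk_closed : closed_in V R;
  walk_exits : Y \subset outside x V;
  walk_exits_nbr : {in Y, forall y, nbr y :&: V \subset R};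
  walk_locked : forall S : {set T}, S \subset V -> closed_in V S -> S :&: R != set0 ->
    exists2 w, w \in S & locked (outside x V) Y w
}.

Lemma clique_sub_closed (W A X : {set T}) a : clique X -> X \subset W ->
  closed_in W A -> a \in A -> a \in X -> X \subset A.
Proof.
move=> clX sX clA aA aX; apply/subsetP=> b bX.
by case: (eqVneq a b) => [<-//|ab]; apply: clA (clX a b aX bX ab); rewrite // (subsetP sX).
Qed.

(* A locked vertex cannot be uncoloured, because its outside neighbours do not
   form a clique. *)
Lemma walk_disjoint x V R Y : walk x V R Y -> [disjoint component (x |: V) x & R].
Proof.
move=> wk; have sx := walk_state wk; have xV := state_notin sx.
rewrite disjoints_subset; apply/subsetP=> u uQ; rewrite inE; apply/negP => uR.
have [|||w wS [lw [y [A [/setDP[yY yA] wy sA /set0Pn[a aA] clA]]]]] :=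
  walk_locked wk (S := component (x |: V) x :\ x).
- apply/subsetP=> v /setD1P[vx /(subsetP (component_sub _ (setU11 _ _)))].
  by rewrite in_setU1 (negbTE vx).
- exact: component_minus_closed.
- apply/set0Pn; exists u; rewrite in_setI in_setD1 uQ uR !andbT.
  by apply: contraNneq xV => <-; apply: (subsetP (walk_sub wk)).
have /setD1P[wx wQ] := wS.
have wW := subsetP (component_sub _ (setU11 x V)) w wQ.
have sw := state_reach sx wQ lw; have outE := outside_reach wW.
have clw := outside_nbr_clique sw; have subw := subsetIr (nbr w) (outside x V).
rewrite outE in clw.
have /setIP[ao wa] := subsetP sA a aA.
have yo := subsetP (walk_exits wk) y yY.
case/negP: yA; apply: (subsetP (clique_sub_closed clw subw clA aA _)).
  by rewrite in_setI wa.
by rewrite in_setI nbrE wy.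
Qed.

(** The uncoloured vertex moves from [x] to a low [y] inside its component [Q], and from there to a
    low outside neighbour [z] of [y]. Then [Q :\ y] joins [R] and [y] joins the exits; [R] grows
    because [Q] was disjoint from it. *)
Lemma walk_step x V R Y :
  (forall w V y, state w V -> y \in V -> e w y -> low y ->
     nbr w :&: outside w V <> nbr y :&: outside w V) ->
  walk x V R Y -> exists z V' R' Y', walk z V' R' Y' /\ #|R| < #|R'|.
Proof.
move=> distinct wk; have sx := walk_state wk; have xV := state_notin sx.
set W := x |: V; set Q := component W x; set O := outside x V.
have xW : x \in W := setU11 x V.
have disQ : [disjoint Q & R] := walk_disjoint wk.
have QR v : v \in Q -> v \notin R by move=> vQ; rewrite (disjointFr disQ vQ).
have sQW : Q \subset W := component_sub e xW.
have [w [y [wQ yQ wy [lw ly yx]]]] : exists w y,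
    [/\ w \in Q, y \in Q, e w y & [/\ low w, low y & y != x]].
  have [w [y [wQ yQ wy lw ly]]] := state_low_edge sx.
  case: (eqVneq y x) => [yx|yx]; last by exists w, y.
  (* Orienting the edge so that [y] differs from [x] keeps [x] in [Q :\ y], where it witnesses the
     growth of [R]. *)
  exists y, w; split; rewrite 1?e_sym //; split=> //.
  by apply: contraTneq wy => ->; rewrite yx e_irr.
have wW := subsetP sQW w wQ; have yW := subsetP sQW y yQ.
have sw : state w (W :\ w) := state_reach sx wQ lw.
set V' := W :\ y; have sy : state y V' := state_reach sx yQ ly.
have wy' : w != y by apply: contraTneq wy => ->; rewrite e_irr.
have wV' : w \in V' by rewrite in_setD1 wy'.
have xV' : x \in V' by rewrite in_setD1 eq_sym yx.
have yV : y \in V by move: yW; rewrite in_setU1 (negbTE yx).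
pose Ay := nbr y :&: O; pose Aw := nbr w :&: O.
have outw : outside w (W :\ w) = O := outside_reach wW.
have outy : outside y V' = O := outside_reach yW.
have clAy : clique Ay by have := outside_nbr_clique sy; rewrite outy.
have clAw : clique Aw by have := outside_nbr_clique sw; rewrite outw.
have closAy : closed_in O Ay by have := outside_nbr_closed sy; rewrite outy.
have closAw : closed_in O Aw by have := outside_nbr_closed sw; rewrite outw.
have cAy : #|Ay| = #|~: P| by have := card_outside_nbr sy; rewrite outy.
have cAw : #|Aw| = #|~: P| by have := card_outside_nbr sw; rewrite outw.
have sAy : Ay \subset O := subsetIr _ _; have sAw : Aw \subset O := subsetIr _ _.
have C3 := PC3.
(* Two cliques closed in [O] that share a vertex coincide, which [distinct] forbids. *)
have Ayw a : a \in Ay -> a \notin Aw.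
  move=> ay; apply/negP => aw; case: (distinct w (W :\ w) y sw) => //.
    by rewrite in_setD1 eq_sym wy'.
  rewrite outw; apply/eqP; rewrite eqEsubset.
  by rewrite (clique_sub_closed clAw sAw closAy ay aw) (clique_sub_closed clAy sAy closAw aw ay).
have [z zA lz] : exists2 z, z \in Ay & low z.
  by apply: (clique_has_low clAy); rewrite cAy ltnW.
have [yz zO] : e y z /\ z \in O by move: zA; rewrite in_setI nbrE => /andP[].
have sz : state z V' by apply: (state_swap sy) lz; rewrite outy.
(* Inner neighbours of old exits lie in [R], which [y] avoids. Hence [z], a neighbour of [y], is not
   an old exit. *)
have Ynbr y0 : y0 \in Y -> ~~ e y y0.
  move=> y0Y; apply: contra (QR y yQ) => yy0.
  by apply: (subsetP (walk_exits_nbr wk y0Y)); rewrite in_setI nbrE e_sym yy0.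
have outz v : (v \in outside z V') = (v == y) || (v \in O) && (v != z).
  rewrite /O /outside /V' /W !inE !negb_or negb_and negb_or negbK; have : y != z.
    by apply: contraTneq yz => ->; rewrite e_irr.
  case: (eqVneq v y) => [->|vy] /= yz'; first by rewrite yz'.
  by rewrite andbC.
pose R' := R :|: (Q :\ y); pose Y' := y |: Y.
have QyV' : Q :\ y \subset V' by apply: setSD.
have sRV := walk_sub wk.
have yA1 a : a \in O -> e a y -> a \in Ay.
  by move=> aO ay; rewrite in_setI nbrE e_sym ay.
exists z, V', R', Y'; split; last first.
  apply: proper_card; rewrite properE subsetUl; apply/subsetPn; exists x.
    by rewrite in_setU in_setD1 eq_sym yx mem_component orbT.
  by apply: QR; apply: mem_component.
have closQ : closed_in V' (Q :\ y).
  move=> u v /setD1P[uy uQ] /setD1P[vy vW] uv; rewrite in_setD1 vy.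
  exact: (component_closed xW uQ vW uv).
split=> //.
- rewrite subUset QyV' andbT; apply/subsetP=> u uR; rewrite in_setD1 in_setU1.
  by rewrite (subsetP sRV u uR) orbT andbT; apply: contraTneq uR => ->; apply: QR.
- move=> u v /setUP[uR|uQ] vV' uv; last by rewrite in_setU (closQ u v uQ vV' uv) orbT.
  have /setD1P[_ /setU1P[vx|vV]] := vV'; last first.
    by rewrite in_setU (walk_closed wk uR vV uv).
  have uQ : u \in Q.
    apply: (component_closed xW (mem_component e W x)); last by rewrite -vx e_sym.
    by rewrite in_setU1 (subsetP sRV u uR) orbT.
  by have := QR u uQ; rewrite uR.
- apply/subsetP=> y0; rewrite outz => /setU1P[->|y0Y]; first by rewrite eqxx.
  rewrite (subsetP (walk_exits wk) y0 y0Y); apply/orP; right.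
  by apply: contraTneq yz => <-; apply: Ynbr.
- move=> y0 /setU1P[->|y0Y]; apply/subsetP=> v /setIP[]; rewrite nbrE => yv vV'.
    have /setD1P[vy vW] := vV'; rewrite in_setU in_setD1 vy /=.
    by rewrite (component_closed xW yQ vW yv) orbT.
  have /setD1P[vy /setU1P[->|vV]] := vV'.
    by rewrite in_setU in_setD1 mem_component eq_sym yx orbT.
  rewrite in_setU (subsetP (walk_exits_nbr wk y0Y)) // in_setI nbrE yv; exact: vV.
(* If [S] meets the component just left, it contains [w], which is now locked; otherwise it meets
   the old [R], and a vertex locked before stays locked. *)
move=> S sS clS; case: (boolP [exists s in S, s \in Q :\ y]).
  case/exists_inP=> s sS' sQ _.
  have clS1 : closed_in V' (S :&: (Q :\ y)).
    move=> u v /setIP[uS uQ] vV' uv.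
    by rewrite in_setI (clS u v uS vV' uv) (closQ u v uQ vV' uv).
  (* Without a neighbour of [y] this set would be closed in [W] and so contain all of [Q], even [y].
     Hence [state_kempe] at [y] puts all inner neighbours of [y] into it. *)
  have /subsetP/(_ w) : nbr y :&: V' \subset S :&: (Q :\ y).
    apply: (state_kempe sy) => //; first by apply: subset_trans (subsetIl _ _) sS.
    apply/negP => /eqP none.
    have : Q \subset S :&: (Q :\ y).
      apply: (component_connected e_sym (y := s)); last by case/setD1P: sQ.
        move=> u v uS vW uv; case: (eqVneq v y) => [vy|vy].
          have : u \in nbr y :&: (S :&: (Q :\ y)) by rewrite in_setI uS nbrE e_sym -vy uv.
          by rewrite none inE.
        by apply: (clS1 u v uS _ uv); rewrite in_setD1 vy.
      by rewrite in_setI sS'.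
    by move/subsetP/(_ y yQ); rewrite !inE eqxx andbF.
  rewrite in_setI nbrE e_sym wy wV' => /(_ isT)/setIP[wS _].
  exists w => //; split=> //; exists y, Aw; split=> //.
  - rewrite in_setD setU11 andbT; apply: contraL yV => /(subsetP sAw).
    by rewrite !inE negb_or => /andP[].
  - apply/subsetP=> a aw; rewrite in_setI outz; have /setIP[-> ->] := aw.
    by rewrite andbT /= [a == z]eq_sym; apply/orP; right; apply: contraTneq aw => <-; apply: Ayw.
  - by rewrite -card_gt0 cAw; apply: leq_trans C3.
  move=> a b aw; have aO := subsetP sAw a aw.
  rewrite outz => /predU1P[->|/andP[bO _]] ab; last exact: closAw ab.
  by have := Ayw a (yA1 a aO ab); rewrite aw.
rewrite negb_exists_in => /forall_inP SQ /set0Pn[s0 /setIP[s0S]].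
rewrite in_setU (negbTE (SQ s0 s0S)) orbF => s0R.
have yS u : u \in S -> ~~ e u y.
  move=> uS; apply: contra (SQ u uS) => uy; have /setD1P[uy' uW] := subsetP sS u uS.
  by rewrite in_setD1 uy'; apply: (component_closed xW yQ uW); rewrite e_sym.
have sSV : S \subset V.
  apply/subsetP=> u uS; have /setD1P[_ /setU1P[ux|//]] := subsetP sS u uS.
  by have := SQ u uS; rewrite in_setD1 ux eq_sym yx mem_component.
have [||w0 w0S [lw0 [y0 [A [/setDP[y0Y y0A] wy0 sA /set0Pn[a aA] clA]]]]] :=
  walk_locked wk sSV.
- move=> u v uS vV uv; case: (eqVneq v y) => [vy|vy].
    by have := yS u uS; rewrite -vy uv.
  by apply: (clS u v uS _ uv); rewrite in_setD1 vy in_setU1 vV orbT.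
- by apply/set0Pn; exists s0; rewrite in_setI s0S.
(* If the walk could enter A, it could proceed through w0, which is adjacent to
   the rest of A but not to y. *)
have disA b : b \in A -> b \notin Ay.
  move=> bA; apply/negP => bAy; have sAyA := clique_sub_closed clAy sAy clA bA bAy.
  have Anbr v : v \in Ay -> e w0 v.
    by move=> /(subsetP sAyA)/(subsetP sA); rewrite in_setI nbrE => /andP[].
  have w0V' := subsetP sS w0 w0S.
  have w0Q : w0 \in component (z |: V') z.
    by apply: mem_component_nbr => //; rewrite e_sym Anbr.
  have sw0 := state_reach sz w0Q lw0.
  have out0 : outside w0 ((z |: V') :\ w0) = outside z V'.
    by apply: outside_reach; rewrite in_setU1 w0V' orbT.
  have /card_gt0P[b' /setD1P[b'z b'A]] : 0 < #|Ay :\ z|.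
    have := cardsD1 z Ay; rewrite zA cAy; clear - C3; lia.
  have clos0 := outside_nbr_closed sw0; rewrite out0 in clos0.
  have : y \in nbr w0 :&: outside z V'.
    apply: (clos0 b').
    - by rewrite in_setI nbrE Anbr // outz b'z (subsetP sAy) // orbT.
    - by rewrite outz eqxx.
    by move: b'A; rewrite in_setI nbrE e_sym => /andP[].
  by rewrite in_setI nbrE (negbTE (yS w0 w0S)).
exists w0 => //; split=> //; exists y0, A; split=> //.
- by rewrite in_setD y0A in_setU1 y0Y orbT.
- apply/subsetP=> b bA; have /setIP[bO bw] := subsetP sA b bA.
  rewrite in_setI bw outz bO andbT; apply/orP; right.
  by apply: contraNneq (disA b bA) => ->.
- by apply/set0Pn; exists a.
move=> b v bA; rewrite outz => /predU1P[->|/andP[vO _]] bv; last exact: clA bv.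
have /setIP[bO _] := subsetP sA b bA.
by have := disA b bA; rewrite yA1.
Qed.

Theorem critical_clique c x : proper_on e [set~ x] c ->
  exists2 X : {set T}, #|X| = #|C|.+1 & clique X.
Proof.
move=> cP; case: (boolP [exists X : {set T}, (#|X| == #|C|.+1) &&
    [forall a in X, forall b in X, (a != b) ==> e a b]]).
  case/existsP=> X /andP[/eqP cX /forall_inP clX]; exists X => // a b aX bX ab.
  by have /forall_inP/(_ b bX)/implyP := clX a aX; apply.
rewrite negb_exists => /forallP none; exfalso.
have distinct w V y : state w V -> y \in V -> e w y -> low y ->
    nbr w :&: outside w V <> nbr y :&: outside w V.
  move=> sw yV wy ly /(common_outside_clique sw yV wy ly)[X cX clX].
  have := none X; rewrite cX eqxx /= => /forall_inPn[a aX] /forall_inPn[b bX].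
  by rewrite negb_imply => /andP[ab]; rewrite clX.
have [x0 [V0 s0]] := state_exists cP.
have start : walk x0 V0 set0 set0.
  split=> //; first exact: sub0set.
  - by move=> u v; rewrite inE.
  - exact: sub0set.
  - by move=> u; rewrite inE.
  by move=> S _ _; rewrite setI0 eqxx.
(* The walk never gets stuck, so [R] would outgrow the finite vertex set. *)
suff grow m : exists z V R Y, walk z V R Y /\ m <= #|R|.
  have [z [V [R [Y [_]]]]] := grow #|T|.+1.
  by rewrite leqNgt ltnS max_card.
elim: m => [|m [z [V [R [Y [wk le]]]]]]; first by exists x0, V0, set0, set0.
have [z' [V' [R' [Y' [wk' lt]]]]] := walk_step distinct wk.
by exists z', V', R', Y'; split=> //; apply: leq_ltn_trans lt.
Qed.
End Critical.

(** * Ore-degree *)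

Lemma chromatic_number_min (G : sgraph) k : colorable G k -> chromatic_number G <= k.
Proof. by rewrite /chromatic_number; case: ex_minnP => m _; apply. Qed.

Lemma leq_ore_degree (G : sgraph) (x y : G) :
  adj x y -> degree x + degree y <= ore_degree G.
Proof.
move=> xy; rewrite /ore_degree.
exact: (@leq_bigmax_cond _ (fun s : G * G => adj s.1 s.2)
  (fun s => edge_ore_degree s.1 s.2) (x, y)).
Qed.

Lemma clique_subgraph (G : sgraph) (X : {set G}) :
  {in X &, forall a b, a != b -> adj a b} ->
  contains_subgraph G (complete_graph #|X|).
Proof.
move=> clX; exists (fun i : 'I_#|X| => enum_val i); split; first exact: enum_val_inj.
move=> i j /= ij; apply: clX; rewrite ?enum_valP //.
by apply: contra_neq ij; apply: enum_val_inj.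
Qed.

Theorem corollaryO (G : sgraph) :
  6 <= chromatic_number G ->
  chromatic_number G = ore_degree G %/ 2 + 1 ->
  contains_subgraph G (complete_graph (chromatic_number G)).
Proof.
move=> chi6 chiE; set n := (chromatic_number G).-1.
have n5 : 5 <= n by rewrite /n; lia.
have chin : chromatic_number G = n.+1 by rewrite /n; lia.
(* The quotient by 2 is exactly [n], so the Ore-degree is at most 2n + 1. *)
have ore : ore_degree G <= n.*2.+1 by lia.
pose col (W : {set G}) := [exists c : {ffun G -> 'I_n},
  [forall u in W, forall v in W, adj u v ==> (c u != c v)]].
have colP (W : {set G}) : reflect (exists c : {ffun G -> 'I_n}, proper_on (@adj G) W c) (col W).
  apply: (iffP existsP) => -[c cP]; exists c.
    move=> u v uW vW uv; have /forall_inP/(_ v vW)/implyP := forall_inP cP u uW.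
    exact.
  by apply/forall_inP=> u uW; apply/forall_inP=> v vW; apply/implyP; apply: cP.
have ncolT : ~~ col setT.
  apply/colP => -[c cP]; have : chromatic_number G <= n; last by rewrite chin ltnn.
  apply: chromatic_number_min; apply/existsP; exists c; apply/forallP=> u.
  by apply/forallP=> v; apply/implyP; apply: cP; rewrite inE.
have [W ncolW minW] :=
  @arg_minnP _ setT (fun W => ~~ col W) (fun W => #|W|) ncolT.
pose T : finType := {x : G | x \in W}; pose e : rel T := fun u v => adj (val u) (val v).
have e_sym : symmetric e by move=> u v; apply: adj_sym.
have e_irr : irreflexive e by move=> u; apply: adj_irrefl.
(* The colours 0 and 1 will form the two-coloured part; [i0] is also the default colour off [W]. *)
pose i0 : 'I_n := Ordinal (ltnW (ltnW (ltnW (ltnW n5)))).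
pose i1 : 'I_n := Ordinal (ltnW (ltnW (ltnW n5))).
have ncol (c : T -> 'I_n) : ~ proper_on e setT c.
  move=> cP; case/negP: ncolW; apply/colP.
  exists [ffun v => if insub v is Some u then c u else i0] => u v uW vW uv.
  by rewrite !ffunE !insubT; apply: cP; rewrite ?inE.
have crit (x : T) : exists c : T -> 'I_n, proper_on e [set~ x] c.
  have /colP[c cP] : col (W :\ val x).
    case: (boolP (col (W :\ val x))) => // /minW.
    by rewrite (cardsD1 (val x) W) (valP x) add1n ltnn.
  exists (fun u => c (val u)) => u v; rewrite !inE => ux vx; apply: cP.
    by rewrite in_setD1 (valP u) andbT (inj_eq val_inj).
  by rewrite in_setD1 (valP v) andbT (inj_eq val_inj).
have deg_ge (x : T) : n <= #|nbr e x|.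
  have [c cP] := crit x.
  (* With all colours in one part, the bound says that every colour occurs around the uncoloured
     vertex. *)
  have := leq_part_nbr e_sym e_irr ncol setT cP; rewrite cardsT card_ord.
  by move/leq_trans; apply; apply: subset_leq_card; apply: subsetIl.
have deg_le (x : T) : #|nbr e x| <= degree (val x).
  rewrite -(card_imset _ val_inj); apply: subset_leq_card.
  by apply/subsetP=> _ /imsetP[u ux ->]; move: ux; rewrite !inE.
have edge_le (x y : T) : e x y -> #|nbr e x| + #|nbr e y| <= n.*2.+1.
  by move=> /leq_ore_degree le; have := deg_le x; have := deg_le y; lia.
(* A neighbour has degree at least [n], which leaves at most n + 1 for [x]; two adjacent high
   vertices would reach 2n + 2. *)
have low_or_high (x : T) : low 'I_n e x \/ #|nbr e x| = #|'I_n|.+1.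
  rewrite /low card_ord; have dx := deg_ge x.
  have /card_gt0P[y] : 0 < #|nbr e x| by lia.
  rewrite nbrE => /edge_le; have := deg_ge y; case: eqP; [by left | right; lia].
have high_indep (x y : T) : e x y -> low 'I_n e x || low 'I_n e y.
  move/edge_le; rewrite /low card_ord; have := deg_ge x; have := deg_ge y.
  by do 2! case: eqP => //=; lia.
have [x0 _] : exists x : T, true.
  case: (set_0Vmem W) => [W0|[x xW]]; last by exists (Sub x xW).
  by case/negP: ncolW; apply/colP; exists [ffun=> i0] => u v; rewrite W0 inE.
have [c cP] := crit x0.
have P2 : #|[set i0; i1]| = 2 by rewrite cards2.
have C5 : 5 <= #|'I_n| by rewrite card_ord.
have [X cX clX] := critical_clique e_sym e_irr ncol P2 C5 low_or_high high_indep cP.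
have := @clique_subgraph G (val @: X); rewrite (card_imset _ val_inj) cX card_ord chin.
apply=> _ _ /imsetP[a aX ->] /imsetP[b bX ->] ab.
exact: clX.
Qed.
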